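(* Let $\alpha$ be a finite set with an involution $\tau:\alpha\to\alpha$, let $k\ge 1$, and let $P$ be a nanophrase of length $k$ over $\alpha$ with $4$ letters. Then $P$ is either homotopic to a nanophrase (of length $k$ over $\alpha$) with less than or equal to $2$ letters or isomorphic to one of the nanophrases $P^{X;Y}_{a,b}$ of length $k$ defined in the context, for some type $X$, some admissible $Y$ and some $a,b\in\alpha$ (with $a\ne\tau(b)$ if $X\in\{4,(2,2I),(2,2II)\}$). Moreover, $P^{X;Y}_{a,b}$ and $P^{X';Y'}_{a',b'}$ are homotopic if and only if $X=X'$, $Y=Y'$, $a=a'$ and $b=b'$.
   Context: Nanophrases. Fix a finite set $\alpha$ with an involution $\tau:\alpha\to\alpha$. An $\alpha$-alphabet is a set $\mathcal{A}$ with a map $\mathcal{A}\to\alpha$, $A\mapsto|A|$. A nanophrase of length $k$ over $\alpha$ is a pair $(\mathcal{A},(w_1|\cdots|w_k))$ with $\mathcal{A}$ an $\alpha$-alphabet and $w_1,\dots,w_k$ (possibly empty) words on $\mathcal{A}$ such that each element of $\mathcal{A}$ occurs exactly twice in the concatenation $w_1w_2\cdots w_k$. A nanophrase ''with $n$ letters'' means that $w_1\cdots w_k$ has length $n$ (so $\mathcal{A}$ has $n/2$ elements). The empty word is denoted $\emptyset$. Two nanophrases of length $k$ are isomorphic if there is a bijection of their alphabets preserving the maps to $\alpha$ and carrying the first sequence of words to the second. Homotopy. Homotopy of nanophrases of length $k$ is the equivalence relation generated by isomorphism and the following moves, where $x,y,z,t$ are words possibly including the separator ''$|$'', and every displayed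 two-letter subword lies inside a single component: (1) $(\mathcal{A},(xAAy))\to(\mathcal{A}\setminus\{A\},(xy))$; (2) $(\mathcal{A},(xAByBAz))\to(\mathcal{A}\setminus\{A,B\},(xyz))$ if $|B|=\tau(|A|)$; (3) $(\mathcal{A},(xAByACzBCt))\to(\mathcal{A},(xBAyCAzCBt))$ if $|A|=|B|=|C|$. (That is, $S$-homotopy with $S$ the diagonal of $\alpha\times\alpha\times\alpha$.) The nanophrases $P^{X;Y}_{a,b}$. They have length $k$, alphabet $\{A,B\}$ with $|A|=a$, $|B|=b$, and all components are empty except those listed (positions satisfy $1\le p<q<r<s\le k$ as far as they occur): $P^{4;p}_{a,b}$: $w_p=ABAB$. $P^{3,1;p,q}_{a,b}$: $w_p=ABA$, $w_q=B$. $P^{2,2I;p,q}_{a,b}$: $w_p=AB$, $w_q=AB$. $P^{2,2II;p,q}_{a,b}$: $w_p=AB$, $w_q=BA$. $P^{1,3;p,q}_{a,b}$: $w_p=A$, $w_q=BAB$. $P^{2,1,1I;p,q,r}_{a,b}$: $w_p=AB$, $w_q=A$, $w_r=B$. $P^{2,1,1II;p,q,r}_{a,b}$: $w_p=BA$, $w_q=A$, $w_r=B$. $P^{1,2,1I;p,q,r}_{a,b}$: $w_p=A$, $w_q=AB$, $w_r=B$. $P^{1,2,1II;p,q,r}_{a,b}$: $w_p=A$, $w_q=BA$, $w_r=B$. $P^{1,1,2I;p,q,r}_{a,b}$: $w_p=A$, $w_q=B$, $w_r=AB$. $P^{1,1,2II;p,q,r}_{a,b}$: $w_p=A$, $w_q=B$,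 $w_r=BA$. $P^{1,1,1,1I;p,q,r,s}_{a,b}$: $w_p=A$, $w_q=A$, $w_r=B$, $w_s=B$. $P^{1,1,1,1II;p,q,r,s}_{a,b}$: $w_p=A$, $w_q=B$, $w_r=A$, $w_s=B$. $P^{1,1,1,1III;p,q,r,s}_{a,b}$: $w_p=A$, $w_q=B$, $w_r=B$, $w_s=A$. Here $X$ denotes the type (one of the 14 types $4$; $3,1$; $2,2I$; $2,2II$; $1,3$; $2,1,1I$; $2,1,1II$; $1,2,1I$; $1,2,1II$; $1,1,2I$; $1,1,2II$; $1,1,1,1I$; $1,1,1,1II$; $1,1,1,1III$) and $Y$ the tuple of positions ($p$, $(p,q)$, $(p,q,r)$ or $(p,q,r,s)$ according to the type). Convention: whenever $P^{4;p}_{a,b}$, $P^{2,2I;p,q}_{a,b}$ or $P^{2,2II;p,q}_{a,b}$ is written, it is assumed that $a\neq\tau(b)$. *)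

(* Defs.v *)
(* Nanophrases over a finite set alpha with involution tau, up to S-homotopy
   for S the diagonal of alpha^3. *)
From mathcomp Require Import all_boot.
From Stdlib Require Import Relation_Operators.

Set Implicit Arguments.
Unset Strict Implicit.
Unset Printing Implicit Defensive.

(* Every letter occurs in the words, so an alphabet is necessarily finite. *)
Record nanophrase (alpha : finType) (k : nat) := Nanophrase {
  letter :> finType;
  lab : letter -> alpha;
  words : k.-tuple (seq letter);
  wordsP : [forall A : letter, count_mem A (flatten words) == 2]
}.

Section Homotopy.
Variables (alpha : finType) (tau : alpha -> alpha) (k : nat).
Implicit Types P Q : nanophrase alpha k.

(* The number of letters counts occurrences, not elements of the alphabet. *)
Definition nletters P : nat := size (flatten (words P)).

(* w_1|w_2|...|w_k as a single sequence in which None is the separator. *)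
Definition barred (T : Type) (ws : seq (seq T)) : seq (option T) :=
  behead (flatten [seq None :: [seq Some A | A <- w] | w <- ws]).

Definition phrase P : seq (option P) := barred (words P).

Definition lab_preserving P Q (f : P -> Q) : Prop :=
  forall A, lab (f A) = lab A.

Definition isomorphic P Q : Prop :=
  exists f : P -> Q,
    [/\ bijective f, lab_preserving f
      & forall i, tnth (words Q) i = [seq f A | A <- tnth (words P) i]].

(* In the moves, an injective label-preserving f : Q -> P identifies the
   alphabet of Q with the alphabet of P minus the deleted letters; a separator
   may occur in x, y, z, t but not between the two letters of a displayed pair.
   Displayed letters are automatically distinct, as each occurs twice. *)
Definition move1 P Q : Prop :=
  exists (A : P) (f : Q -> P) (x y : seq (option P)),
    [/\ injective f /\ lab_preserving f,
        codom f =i [predC [:: A]],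
        phrase P = x ++ [:: Some A; Some A] ++ y
      & map (omap f) (phrase Q) = x ++ y].

Definition move2 P Q : Prop :=
  exists (A B : P) (f : Q -> P) (x y z : seq (option P)),
    [/\ lab B = tau (lab A),
        injective f /\ lab_preserving f,
        codom f =i [predC [:: A; B]],
        phrase P = x ++ [:: Some A; Some B] ++ y ++ [:: Some B; Some A] ++ z
      & map (omap f) (phrase Q) = x ++ y ++ z].

Definition move3 P Q : Prop :=
  exists (A B C : P) (f : Q -> P) (x y z t : seq (option P)),
    [/\ lab A = lab B /\ lab B = lab C,
        bijective f /\ lab_preserving f,
        phrase P = x ++ [:: Some A; Some B] ++ y ++ [:: Some A; Some C]
                     ++ z ++ [:: Some B; Some C] ++ t
      & map (omap f) (phrase Q) =
          x ++ [:: Some B; Some A] ++ y ++ [:: Some C; Some A]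
            ++ z ++ [:: Some C; Some B] ++ t].

Definition step P Q : Prop :=
  [\/ isomorphic P Q, move1 P Q, move2 P Q | move3 P Q].

Definition homotopic : nanophrase alpha k -> nanophrase alpha k -> Prop :=
  clos_refl_sym_trans (nanophrase alpha k) step.

End Homotopy.

Inductive ptype :=
  | T4 | T31 | T22I | T22II | T13
  | T211I | T211II | T121I | T121II | T112I | T112II
  | T1111I | T1111II | T1111III.

(* The nonempty words of each type, in order; the letters A and B are encoded
   as the booleans true and false. *)
Definition pattern (X : ptype) : seq (seq bool) :=
  let A := true in let B := false in
  match X with
  | T4       => [:: [:: A; B; A; B]]
  | T31      => [:: [:: A; B; A]; [:: B]]
  | T22I     => [:: [:: A; B]; [:: A; B]]
  | T22II    => [:: [:: A; B]; [:: B; A]]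
  | T13      => [:: [:: A]; [:: B; A; B]]
  | T211I    => [:: [:: A; B]; [:: A]; [:: B]]
  | T211II   => [:: [:: B; A]; [:: A]; [:: B]]
  | T121I    => [:: [:: A]; [:: A; B]; [:: B]]
  | T121II   => [:: [:: A]; [:: B; A]; [:: B]]
  | T112I    => [:: [:: A]; [:: B]; [:: A; B]]
  | T112II   => [:: [:: A]; [:: B]; [:: B; A]]
  | T1111I   => [:: [:: A]; [:: A]; [:: B]; [:: B]]
  | T1111II  => [:: [:: A]; [:: B]; [:: A]; [:: B]]
  | T1111III => [:: [:: A]; [:: B]; [:: B]; [:: A]]
  end.

Record positions (k : nat) (X : ptype) := Positions {
  pos :> seq 'I_k;
  pos_size : size pos == size (pattern X);
  pos_sorted : sorted ltn [seq nat_of_ord i | i <- pos]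
}.

(* Component i is the j-th word of the pattern if i is the j-th position, and
   is empty (the default of nth) if i is not one of the positions. *)
Definition std_words (k : nat) (X : ptype) (Y : positions k X) :
    k.-tuple (seq bool) :=
  [tuple nth [::] (pattern X) (index i Y) | i < k].

Lemma std_wordsP (k : nat) (X : ptype) (Y : positions k X) :
  [forall A : bool, count_mem A (flatten (std_words Y)) == 2].
Proof.
have uY : uniq Y.
  have := sorted_uniq ltn_trans ltnn (pos_sorted Y).
  by rewrite map_inj_uniq //; apply: val_inj.
have sY : size Y = size (pattern X) by apply/eqP/pos_size.
apply/forallP=> A; rewrite count_flatten sumnE !big_map.
rewrite -[Finite.enum _]enumT big_enum /=.
rewrite (bigID (mem (Y : seq 'I_k))) /= [X in _ + X]big1 ?addn0; last first.
  by move=> i iY; rewrite nth_default // -sY leqNgt index_mem.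
rewrite -big_uniq //=.
have -> : \sum_(i <- Y) count_mem A (nth [::] (pattern X) (index i Y))
        = \sum_(w <- pattern X) count_mem A w.
  rewrite [RHS](big_nth [::]) -sY.
  case EY: (Y : seq _) => [|i0 s]; first by rewrite big_nil big_geq.
  rewrite -EY (big_nth i0); apply: eq_big_nat => j /andP[_ jY].
  by rewrite index_uniq.
by case: X {Y uY sY}; case: A; rewrite !big_cons big_nil.
Qed.

(* The nanophrase P^{X;Y}_{a,b}. *)
Definition nanoP (alpha : finType) (k : nat) (X : ptype) (Y : positions k X)
    (a b : alpha) : nanophrase alpha k :=
  @Nanophrase alpha k bool (fun c => if c then a else b) (std_words Y)
    (std_wordsP Y).

Definition admissible (alpha : finType) (tau : alpha -> alpha) (X : ptype)
    (a b : alpha) : Prop :=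
  match X with
  | T4 | T22I | T22II => a <> tau b
  | _ => True
  end.

(* Main.v *)
Require Import Defs.
From mathcomp Require Import all_boot all_algebra zify.
From Stdlib Require Import Relation_Operators.

(* With four letters the word is AABB, ABAB or ABBA, cut into components in one
   of eight ways; those not listed are shortened by move (1), by move (2), or,
   for xAByABz with |B| = tau(|A|), by a chain of moves (Turaev).

   The listed nanophrases are told apart by two homotopy invariants.
   - Give a letter A the triple (i, j, d), where i and j are the components of
     its two occurrences and d is the parity of the distance between them.
     Ignoring the triples (i, i, odd), which move (1) creates, add up over the
     letters with a given triple a vector [charge |A|], where
     charge (tau a) = - charge a.  Move (2) removes two opposite contributions;
     move (3) moves both occurrences of each displayed letter by one place,
     which changes neither the components nor the parity.
   - Read each component in the group generated by alpha with tau(a) = a^-1, a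
     first occurrence of A as |A| and a second one as tau(|A|).
   The first invariant determines the type, the positions and the labels, except
   that in the types 4, (2,2I) and (2,2II) both letters have the same triple;
   the second one then separates the labels a and b. *)

Set Implicit Arguments.
Unset Strict Implicit.
Unset Printing Implicit Defensive.

Import GRing.Theory.

(** * Phrases as lists of occurrences *)

(** Separators survive only as jumps of the component index, which starts at [n]; two neighbouring
    entries with equal index are adjacent letters of one component. *)
Fixpoint occs (T : Type) (n : nat) (s : seq (option T)) : seq (nat * T) :=
  match s with
  | [::] => [::]
  | None :: s' => occs n.+1 s'
  | Some A :: s' => (n, A) :: occs n s'
  end.

Definition nbars (T : Type) (s : seq (option T)) : nat := count (fun o => ~~ isSome o) s.

Section Phrases.
Variable T : Type.
Implicit Types (s x y : seq (option T)) (w : seq T) (ws : seq (seq T)).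

Lemma occs_cat n x y : occs n (x ++ y) = occs n x ++ occs (n + nbars x) y.
Proof.
elim: x n => [|[A|] x IH] n /=; rewrite ?addn0 //; rewrite IH; first by rewrite /nbars /=.
by rewrite /nbars /= addSnnS.
Qed.

Lemma occs_map (T' : Type) (f : T -> T') n s :
  occs n (map (omap f) s) = [seq (e.1, f e.2) | e <- occs n s].
Proof. by elim: s n => [|[A|] s IH] n //=; rewrite IH. Qed.

Lemma occs_consE n s i A e : occs n s = (i, A) :: e ->
  exists2 s', s = nseq (i - n) None ++ Some A :: s' & n <= i /\ occs i s' = e.
Proof.
elim: s n => [|[B|] s IH] n //=.
  by case=> -> -> <-; exists s; rewrite ?subnn.
move=> /IH[s' -> [ni <-]]; exists s'; last by split=> //; apply: ltnW.
by rewrite -(subnSK ni).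
Qed.

Lemma occs_nilE n s : occs n s = [::] -> s = nseq (nbars s) None.
Proof. by elim: s n => [|[A|] s IH] n //= /IH {1}->. Qed.

Lemma nbars_cat x y : nbars (x ++ y) = nbars x + nbars y.
Proof. exact: count_cat. Qed.

(** The occurrences forget the separators that follow the last letter; the number of separators
    restores them. *)
Lemma occs_inj n s s' : nbars s = nbars s' -> occs n s = occs n s' -> s = s'.
Proof.
elim: s n s' => [|[A|] s IH] n s' /=.
- move=> e /esym/occs_nilE ->.
  by rewrite -e.
- move=> e /esym /occs_consE[t Es' [_ Et]].
  move: e; rewrite Es' subnn /nbars /= => e.
  by congr (_ :: _); apply: (IH n).
case: s' => [|[B|] s'] //=.
  move=> _ /occs_consE [t _ [+ _]]; by rewrite ltnn.
by move=> [e] /IH ->.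
Qed.

Lemma barred1 w : barred [:: w] = map Some w.
Proof. by rewrite /barred /= cats0. Qed.

Lemma barred_cons w w' ws :
  barred (w :: w' :: ws) = map Some w ++ None :: barred (w' :: ws).
Proof. by rewrite /barred. Qed.

Lemma nbars_barred ws : nbars (barred ws) = (size ws).-1.
Proof.
case: ws => [|w ws] //; elim: ws w => [|w' ws IH] w.
  by rewrite barred1 /nbars count_map /= (eq_count (a2 := pred0)) ?count_pred0.
rewrite barred_cons nbars_cat {2}/nbars /= -/(nbars _) IH.
by rewrite /nbars count_map /= (eq_count (a2 := pred0)) ?count_pred0.
Qed.

Lemma barred_surj s : exists2 ws, size ws = (nbars s).+1 & barred ws = s.
Proof.
elim: s => [|o s [[|w ws] // sz es]]; last subst s; last case: o => [A|].
- by exists [:: [::]].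
- exists ((A :: w) :: ws); first exact: sz.
  by case: ws {sz} => [|w' ws]; rewrite ?barred1 ?barred_cons.
- by exists [:: [::], w & ws]; [exact: (congr1 succn sz) | rewrite barred_cons].
Qed.

Lemma occs_Some n (w : seq T) x : occs n (map Some w ++ x) = map (pair n) w ++ occs n x.
Proof. by elim: w => //= A w ->. Qed.

Lemma occs_barred n ws : occs n (barred ws) =
  flatten [seq [seq (e.1, A) | A <- e.2] | e <- zip (iota n (size ws)) ws].
Proof.
elim: ws n => [|w ws IH] n //.
case: ws IH => [|w' ws] IH.
  by rewrite barred1 -[map Some w]cats0 occs_Some.
by rewrite barred_cons occs_Some /= (IH n.+1).
Qed.

Lemma unzip2_occs n ws : unzip2 (occs n (barred ws)) = flatten ws.
Proof.
rewrite occs_barred; elim: ws n => //= w ws IH n.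
rewrite /unzip2 map_cat -map_comp map_id; congr (_ ++ _); exact: IH.
Qed.

(** This reads the words back from the barred form, which therefore determines the phrase. Past the
    last word both sides are empty. *)
Lemma nth_occs n ws i : nth [::] ws i =
  [seq e.2 | e <- occs n (barred ws) & e.1 == n + i].
Proof.
rewrite occs_barred; elim: ws n i => [|w ws IH] n i; first by rewrite nth_nil.
rewrite /= filter_cat filter_map map_cat.
case: i => [|i] /=.
  rewrite addn0 (eq_filter (a2 := predT)) => [|A /=]; last by rewrite eqxx.
  rewrite filter_predT -map_comp map_id -[LHS]cats0; congr (_ ++ _).
  (* The later words are started at an arbitrary [m] above [n], so that the induction goes through;
     their entries never have index [n]. *)
  have : n < n.+1 by [].
  elim: {IH} ws {2 3}n.+1 => //= w' ws IH m nm.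
  rewrite filter_cat map_cat -IH ?cats0 ?(ltn_trans nm) // filter_map.
  by rewrite (eq_filter (a2 := pred0)) ?filter_pred0 // => A /=; rewrite gtn_eqF.
rewrite (eq_filter (a2 := pred0)) ?filter_pred0 /=; last first.
  by move=> A /=; rewrite ltn_eqF // -addSnnS ltnS leq_addr.
by rewrite addnS -addSn -IH.
Qed.

End Phrases.

Lemma barred_map (T T' : Type) (f : T -> T') (ws : seq (seq T)) :
  barred (map (map f) ws) = map (omap f) (barred ws).
Proof.
case: ws => // w ws; elim: ws w => [|w' ws IH] w.
  by rewrite /= !barred1 -!map_comp.
by rewrite /= !barred_cons map_cat /= -IH -!map_comp.
Qed.

Lemma count_occs (T : eqType) n (s : seq (option T)) A :
  count_mem A (unzip2 (occs n s)) = count_mem (Some A) s.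
Proof. by elim: s n => [|[B|] s IH] n //=; rewrite IH. Qed.

(** * Moves up to renaming of letters *)

Section Realization.
Variables (alpha : finType) (tau : alpha -> alpha) (k : nat).
Variables (T : finType) (labT : T -> alpha).
Implicit Types (P Q : nanophrase alpha k) (s x y z t : seq (option T)).

Lemma phrase_inj (L : Type) (ws ws' : k.-tuple (seq L)) :
  barred ws = barred ws' -> ws = ws'.
Proof.
move=> e; apply/val_inj/(@eq_from_nth _ [::]); first by rewrite !size_tuple.
by move=> i _; rewrite !(nth_occs 0) e.
Qed.

Lemma count_phrase P (A : P) : count_mem (Some A) (phrase P) = 2.
Proof.
by rewrite -(count_occs 0) unzip2_occs; apply/eqP; move/forallP: (wordsP P).
Qed.

Lemma mem_phrase P (A : P) : Some A \in phrase P.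
Proof. by rewrite -has_pred1 has_count count_phrase. Qed.

Lemma nbars_phrase P : nbars (phrase P) = k.-1.
Proof. by rewrite nbars_barred size_tuple. Qed.

Lemma nlettersE P : nletters P = size (occs 0 (phrase P)).
Proof. by rewrite /nletters -(unzip2_occs 0) size_map. Qed.

(* [P] is [s] up to renaming.  Letters of [T] need not occur in [s], so all the
   phrases of a chain of moves can be written over one [T]. *)
Definition realizes P s : Prop :=
  exists g : P -> T,
    [/\ injective g, forall A, labT (g A) = lab A & map (omap g) (phrase P) = s].

(** For [0 < k] this characterises the sequences that some nanophrase realises. Only letters
    occurring in [s] are counted, since [T] may hold spare ones. *)
Definition valid s : Prop :=
  nbars s = k.-1 /\ forall A, Some A \in s -> count_mem (Some A) s = 2.

Lemma omap_inj (L L' : Type) (g : L -> L') : injective g -> injective (omap g).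
Proof. by move=> gI [A|] [B|] //= [/gI->]. Qed.

Lemma nbars_map (L L' : Type) (g : L -> L') (s : seq (option L)) :
  nbars (map (omap g) s) = nbars s.
Proof. by rewrite /nbars count_map; apply: eq_count => -[]. Qed.

Lemma realizes_valid P s : realizes P s -> valid s.
Proof.
case=> g [gI _ <-]; split=> [|A /mapP[[B|] // _ [->]]].
  by rewrite nbars_map nbars_phrase.
rewrite count_map -[RHS](count_phrase B); apply: eq_count => -[C|] //=.
by rewrite !(inj_eq (@Some_inj _)) inj_eq.
Qed.

Lemma realizes_nletters P s : realizes P s -> nletters P = size (occs 0 s).
Proof. by case=> g [_ _ <-]; rewrite nlettersE occs_map size_map. Qed.

Lemma valid_realizes s : 0 < k -> valid s -> exists P, realizes P s.
Proof.
move=> k_gt0 [nb cnt]; have [ws sz Es] := barred_surj s.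
have szk : size ws == k by rewrite sz nb prednK.
(* The alphabet is cut down to the letters that occur; [pmap insub] then loses none of the words. *)
pose L : finType := {A : T | Some A \in s}.
pose g : L -> T := val.
pose ws' : k.-tuple (seq L) := map_tuple (pmap insub) (Tuple szk).
have Ews : map (map g) ws' = ws.
  rewrite -map_comp map_id_in // => w ws_w /=.
  rewrite pmap_filter; last exact: insubK.
  apply/all_filterP/allP => A Aw /=.
  rewrite isSome_insub -Es -has_pred1 has_count -(count_occs 0) unzip2_occs.
  by rewrite -has_count has_pred1; apply/flattenP; exists w.
have Eph : map (omap g) (barred ws') = s by rewrite -barred_map Ews.
have ok : [forall A : L, count_mem A (flatten ws') == 2].
  apply/forallP => A; rewrite -(unzip2_occs 0) count_occs; apply/eqP.
  rewrite -(cnt (g A)) ?(valP A) // -Eph count_map.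
  by apply: eq_count => -[B|].
exists (@Nanophrase alpha k L (labT \o g) ws' ok), g.
by split=> //; apply: val_inj.
Qed.

(** The embedding of alphabets that the moves ask for is obtained by comparing the two renamings
    inside [T]: [f] is the renaming of [Q] followed by the inverse of that of [P]. *)
Lemma realizes_pullback P Q s s' : realizes P s -> realizes Q s' ->
  {subset s' <= s} ->
  exists gP : P -> T, exists f : Q -> P,
    [/\ injective gP /\ (forall A, labT (gP A) = lab A),
        map (omap gP) (phrase P) = s, injective f /\ lab_preserving f,
        forall A, (A \in codom f) = (Some (gP A) \in s')
      & map (omap gP) (map (omap f) (phrase Q)) = s'].
Proof.
move=> [gP [gPI gPl gPs]] [gQ [gQI gQl gQs]] sub.
have memQ B : Some (gQ B) \in s'.
  by rewrite -gQs -[Some _]/(omap gQ (Some B)) map_f // mem_phrase.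
have pre B : {A | gP A = gQ B}.
  have : gQ B \in codom gP.
    have := sub _ (memQ B); rewrite -gPs => /mapP[[A|] // _ [->]].
    exact: codom_f.
  by move=> e; exists (iinv e); rewrite f_iinv.
pose f B := sval (pre B).
have fE B : gP (f B) = gQ B by exact: svalP (pre B).
have fI : injective f by move=> B C e; apply: gQI; rewrite -!fE e.
have gfs : map (omap gP) (map (omap f) (phrase Q)) = s'.
  by rewrite -gQs -map_comp; apply: eq_map => -[B|] //=; rewrite fE.
exists gP, f; split=> //.
  by split=> // B; rewrite -gPl fE gQl.
move=> A; apply/codomP/idP => [[B ->]|]; first by rewrite fE.
by rewrite -gQs => /mapP[[B|] // _ [e]]; exists B; apply: gPI; rewrite fE.
Qed.

(** When both sequences are [s], the embedding of [realizes_pullback] is onto, because every letter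
    of a nanophrase occurs in its phrase. *)
Lemma realizes_iso P Q s : realizes P s -> realizes Q s -> isomorphic P Q.
Proof.
move=> rP rQ; have [gQ [f [[gQI _] gQs [fI fl] cf gfs]]] := realizes_pullback rQ rP (fun=> id).
exists f; split=> //.
  have fS A : A \in codom f by rewrite cf -gQs (map_f (omap gQ) (mem_phrase A)).
  exists (fun A => iinv (fS A)) => A; last by rewrite f_iinv.
  by apply: fI; rewrite f_iinv.
move=> i; have : words Q = map_tuple (map f) (words P).
  apply: phrase_inj; rewrite /= barred_map; apply: (inj_map (omap_inj gQI)).
  by rewrite gQs.
by move=> ->; rewrite tnth_map.
Qed.

Lemma split_map (L : Type) (g : L -> T) (s0 : seq (option L)) x y :
  map (omap g) s0 = x ++ y ->
  exists x0 y0 : seq (option L), [/\ s0 = x0 ++ y0, map (omap g) x0 = x & map (omap g) y0 = y].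
Proof.
move=> e; exists (take (size x) s0), (drop (size x) s0).
by rewrite cat_take_drop map_take map_drop e take_size_cat // drop_size_cat.
Qed.

Lemma split_map2 (L : Type) (g : L -> T) (s0 : seq (option L)) A B y :
  map (omap g) s0 = [:: Some A; Some B] ++ y ->
  exists (A0 B0 : L) (y0 : seq (option L)), [/\ s0 = [:: Some A0; Some B0] ++ y0, g A0 = A, g B0 = B
    & map (omap g) y0 = y].
Proof.
case: s0 => [|[A0|] [|[B0|] y0]] //= [EA EB Ey].
by exists A0, B0, y0.
Qed.

Lemma valid_rem s s' A : valid s -> perm_eq s ([:: Some A; Some A] ++ s') ->
  Some A \notin s'.
Proof.
move=> [_ cnt] ss'; have As : Some A \in s by rewrite (perm_mem ss') inE eqxx.
have := cnt A As; rewrite (permP ss') /= eqxx => -[/eqP].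
by rewrite -leqn0 leqNgt -has_count has_pred1.
Qed.

Lemma valid_perm s s' : perm_eq s s' -> valid s -> valid s'.
Proof.
move=> ss' [nb cnt]; split; first by rewrite -nb /nbars (permP ss').
by move=> A; rewrite -(perm_mem ss') -(permP ss'); apply: cnt.
Qed.

Lemma valid_del A s : valid ([:: Some A; Some A] ++ s) -> valid s.
Proof.
move=> vs; have nA := valid_rem vs (perm_refl _).
case: vs => nb cnt; split=> // B Bs.
have := cnt B; rewrite !inE Bs !orbT => /(_ isT) /=.
by case: eqP nA => // ->; rewrite Bs.
Qed.

Lemma valid_ins A s : Some A \notin s -> valid s -> valid ([:: Some A; Some A] ++ s).
Proof.
move=> nA [nb cnt]; split=> // B; rewrite !inE /= orbA orbb => /orP[/eqP e|Bs].
  by rewrite e eqxx (count_memPn nA).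
by rewrite cnt //; case: eqP nA => // ->; rewrite Bs.
Qed.

(** All realisations are meant; those of one sequence are isomorphic. The relation is vacuous for a
    sequence without realisation, so transitivity asks for a valid middle term. *)
Definition equivalent s s' : Prop :=
  forall P Q, realizes P s -> realizes Q s' -> homotopic tau P Q.

Lemma equivalent_sym s s' : equivalent s s' -> equivalent s' s.
Proof. by move=> e P Q rP rQ; apply: rst_sym; apply: e. Qed.

Lemma equivalent_trans s s' s'' : 0 < k -> valid s' ->
  equivalent s s' -> equivalent s' s'' -> equivalent s s''.
Proof.
move=> k_gt0 /(valid_realizes k_gt0)[Q rQ] e e' P R rP rR.
by apply: rst_trans (e _ _ rP rQ) (e' _ _ rQ rR).
Qed.

(** The factorisation is pulled back along the injective renaming. Both displayed occurrences come
    from one letter, which by [valid_rem] is the one missed by the embedding of alphabets. *)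
Lemma equivalent1 A x y : equivalent (x ++ [:: Some A; Some A] ++ y) (x ++ y).
Proof.
move=> P Q rP rQ; apply: rst_step; constructor 2.
have vP := realizes_valid rP.
have pm : perm_eq (x ++ [:: Some A; Some A] ++ y) ([:: Some A; Some A] ++ x ++ y).
  by rewrite perm_catCA.
have nA := valid_rem vP pm.
have [|g [f [[gI gl] gs fIl cf gfs]]] := realizes_pullback rP rQ.
  by move=> a aQ; rewrite (perm_mem pm) /= !inE aQ !orbT.
have [x0 [y1 [e1 e2 e3]]] := split_map gs.
have [A0 [A1 [y0 [e4 e5 e6 e7]]]] := split_map2 e3.
have E : A1 = A0 by apply: gI; rewrite e5 e6.
exists A0, f, x0, y0; split=> //.
- move=> B; rewrite cf !inE -(inj_eq gI) e5.
  have := mem_phrase B; rewrite -(mem_map (omap_inj gI)) gs (perm_mem pm) /= !inE.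
  rewrite (inj_eq (@Some_inj _)); case: eqP => [->|_] //=.
  by rewrite (negPf nA).
- by rewrite e1 e4 E.
- by apply: (inj_map (omap_inj gI)); rewrite gfs map_cat e2 e7.
Qed.

Lemma equivalent2 A B x y z : labT B = tau (labT A) ->
  equivalent (x ++ [:: Some A; Some B] ++ y ++ [:: Some B; Some A] ++ z)
    (x ++ y ++ z).
Proof.
move=> lAB P Q rP rQ; apply: rst_step; constructor 3.
have vP := realizes_valid rP.
set s := (X in valid X) in vP.
(* Each displayed letter is brought to the front in turn, so that [valid_rem] excludes it from the
   rest. *)
have pmA : perm_eq s ([:: Some A; Some A] ++ [:: Some B; Some B] ++ x ++ y ++ z).
  by apply/permP => p; rewrite !count_cat /=; lia.
have pmB : perm_eq s ([:: Some B; Some B] ++ [:: Some A; Some A] ++ x ++ y ++ z).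
  by apply/permP => p; rewrite !count_cat /=; lia.
have nA := valid_rem vP pmA; have nB := valid_rem vP pmB.
have [|g [f [[gI gl] gs fIl cf gfs]]] := realizes_pullback rP rQ.
  by move=> a aQ; rewrite (perm_mem pmA) /= !inE aQ !orbT.
have [x0 [y1 [e1 e2 e3]]] := split_map gs.
have [A0 [B0 [y2 [e4 e5 e6 e7]]]] := split_map2 e3.
have [y0 [z1 [e8 e9 e10]]] := split_map e7.
have [B1 [A1 [z0 [e11 e12 e13 e14]]]] := split_map2 e10.
have E : A1 = A0 by apply: gI; rewrite e5 e13.
have E' : B1 = B0 by apply: gI; rewrite e6 e12.
exists A0, B0, f, x0, y0, z0; split=> //.
- by rewrite -!gl e5 e6.
- move=> D; rewrite cf !inE -!(inj_eq gI) e5 e6.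
  have := mem_phrase D; rewrite -(mem_map (omap_inj gI)) gs.
  rewrite -/s (perm_mem pmA) /= !inE !(inj_eq (@Some_inj _)).
  case: eqP => [->|_] /=; first by move: nA; rewrite mem_cat => /norP[_ /negPf].
  case: eqP => [->|_] //=; by move: nB; rewrite mem_cat => /norP[_ /negPf].
- by rewrite e1 e4 e8 e11 E E'.
- by apply: (inj_map (omap_inj gI)); rewrite gfs !map_cat e2 e9 e14.
Qed.

Lemma equivalent3 A B C x y z t : labT A = labT B -> labT B = labT C ->
  equivalent
    (x ++ [:: Some A; Some B] ++ y ++ [:: Some A; Some C] ++ z ++ [:: Some B; Some C] ++ t)
    (x ++ [:: Some B; Some A] ++ y ++ [:: Some C; Some A] ++ z ++ [:: Some C; Some B] ++ t).
Proof.
move=> lAB lBC P Q rP rQ; apply: rst_step; constructor 4.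
set s := (X in realizes P X) in rP; set s' := (X in realizes Q X) in rQ.
(* The third move only permutes occurrences; both sides have the same letters and the embedding is
   bijective. *)
have pm : perm_eq s' s by apply/permP => p; rewrite !count_cat /=; lia.
have [|g [f [[gI gl] gs [fI fl] cf gfs]]] := realizes_pullback rP rQ.
  by move=> a; rewrite (perm_mem pm).
have [x0 [y1 [e1 e2 e3]]] := split_map gs.
have [A0 [B0 [y2 [e4 e5 e6 e7]]]] := split_map2 e3.
have [y0 [z1 [e8 e9 e10]]] := split_map e7.
have [A1 [C0 [z2 [e11 e12 e13 e14]]]] := split_map2 e10.
have [z0 [t1 [e15 e16 e17]]] := split_map e14.
have [B1 [C1 [t0 [e18 e19 e20 e21]]]] := split_map2 e17.
have E : A1 = A0 by apply: gI; rewrite e5 e12.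
have E' : B1 = B0 by apply: gI; rewrite e6 e19.
have E'' : C1 = C0 by apply: gI; rewrite e13 e20.
exists A0, B0, C0, f, x0, y0, z0, t0; split=> //.
- by rewrite -!gl e5 e6 e13.
- split=> //.
  have fS D : D \in codom f.
    by rewrite cf (perm_mem pm) -gs (map_f (omap g) (mem_phrase D)).
  exists (fun D => iinv (fS D)) => D; last by rewrite f_iinv.
  by apply: fI; rewrite f_iinv.
- by rewrite e1 e4 e8 e11 e15 e18 E E' E''.
- apply: (inj_map (omap_inj gI)).
  by rewrite gfs !map_cat /= e2 e5 e6 e9 e13 e16 e21.
Qed.

End Realization.

(** * Reductions of the number of letters *)

Section Reduction.
Variables (alpha : finType) (tau : alpha -> alpha) (k : nat).
Hypotheses (tauK : involutive tau) (k_gt0 : 0 < k).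
Implicit Types P Q : nanophrase alpha k.

Lemma realizes_phrase P : realizes (@lab _ _ P) P (phrase P).
Proof.
exists id; split=> //; rewrite -[RHS]map_id; apply: eq_map => -[] //.
Qed.

Lemma size_occs (L : Type) n (s : seq (option L)) : size (occs n s) + nbars s = size s.
Proof. by by elim: s n => [|[A|] s IH] n //=; [rewrite -(IH n) | rewrite -(IH n.+1) -addnS].
Qed.

Lemma realizes_size (T : finType) (labT : T -> alpha) P s :
  realizes labT P s -> nletters P + k.-1 = size s.
Proof.
by move=> rP; rewrite (realizes_nletters rP) -(proj1 (realizes_valid rP)) size_occs.
Qed.

(** Sizes of sequences can replace numbers of letters because all phrases of length [k] contain
    [k.-1] separators. *)
Lemma reduce (T : finType) (labT : T -> alpha) P s s' :
  realizes labT P s -> valid k s' -> equivalent tau k labT s s' ->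
  exists Q, homotopic tau P Q /\ nletters Q + size s = nletters P + size s'.
Proof.
move=> rP /(valid_realizes labT k_gt0)[Q rQ] e; exists Q; split; first exact: e.
by rewrite -(realizes_size rP) -(realizes_size rQ); lia.
Qed.

Lemma reduce1 P (A : P) x y : phrase P = x ++ [:: Some A; Some A] ++ y ->
  exists Q, homotopic tau P Q /\ nletters Q + 2 = nletters P.
Proof.
move=> e; have rP := realizes_phrase P; rewrite e in rP.
have [|Q [h sz]] := reduce rP _ (@equivalent1 _ tau _ _ _ _ _ _).
  apply: (@valid_del k _ A).
  by apply: valid_perm (realizes_valid rP); rewrite perm_catCA.
by exists Q; split=> //; move: sz; rewrite !size_cat /=; lia.
Qed.

Lemma reduce2 P (A B : P) x y z : lab B = tau (lab A) ->
  phrase P = x ++ [:: Some A; Some B] ++ y ++ [:: Some B; Some A] ++ z ->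
  exists Q, homotopic tau P Q /\ nletters Q + 4 = nletters P.
Proof.
move=> lAB e; have rP := realizes_phrase P; rewrite e in rP.
have [|Q [h sz]] := reduce rP _ (@equivalent2 _ tau _ _ _ _ _ _ _ _ lAB).
  apply: (@valid_del k _ A); apply: (@valid_del k _ B).
  apply: valid_perm (realizes_valid rP).
  by apply/permP => p; rewrite !count_cat /=; lia.
by exists Q; split=> //; move: sz; rewrite !size_cat /=; lia.
Qed.

(* Two inverse second moves insert pq...qp and rs...sr; the third move on q, s, B
   then makes second moves on (s, A) and (r, B) possible. *)
Lemma reduce2' P (A B : P) x y z : lab B = tau (lab A) ->
  phrase P = x ++ [:: Some A; Some B] ++ y ++ [:: Some A; Some B] ++ z ->
  exists Q, homotopic tau P Q /\ nletters Q + 4 = nletters P.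
Proof.
move=> lAB e.
(* Four new letters: the second boolean separates the pair [p], [q] from the pair [r], [s], and the
   first chooses the label, that of [A] for [p], [r] and that of [B] for [q], [s]. *)
pose T : finType := (P + bool * bool)%type.
pose labT (c : T) := match c with
  | inl D => lab D | inr (b, _) => if b then lab A else lab B end.
pose p : T := inr (true, true); pose q : T := inr (false, true).
pose r : T := inr (true, false); pose s : T := inr (false, false).
pose A' : T := inl A; pose B' : T := inl B.
pose up := map (omap (inl : P -> T)).
have rP : realizes labT P (up x ++ [:: Some A'; Some B'] ++ up y ++ [:: Some A'; Some B'] ++ up z).
  by exists inl; split=> // [D E [] //|]; rewrite e !map_cat.
have new b c (u : seq (option P)) : Some (inr (b, c) : T) \notin up u.
  by apply/mapP => -[[D|]].
have lBA : lab A = tau (lab B) by rewrite lAB tauK.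
move: rP; set w0 := (X in realizes _ _ X) => rP.
have v0 : valid k w0 := realizes_valid rP.
pose w1 := up x ++ [:: Some p; Some q] ++ [:: Some A'; Some B'] ++ [:: Some q; Some p]
  ++ up y ++ [:: Some A'; Some B'] ++ up z.
(* The bracketing displays the three pairs of the third move, which runs from [w3] to [w2] on [q],
   [s], [B'], all labelled like [B]. *)
pose w2 := (up x ++ [:: Some p; Some r]) ++ [:: Some s; Some q] ++ [:: Some A']
  ++ [:: Some B'; Some q] ++ ([:: Some p] ++ up y ++ [:: Some A']) ++ [:: Some B'; Some s]
  ++ [:: Some r] ++ up z.
pose w3 := (up x ++ [:: Some p; Some r]) ++ [:: Some q; Some s] ++ [:: Some A']
  ++ [:: Some q; Some B'] ++ ([:: Some p] ++ up y ++ [:: Some A']) ++ [:: Some s; Some B']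
  ++ [:: Some r] ++ up z.
pose w4 := (up x ++ [:: Some p; Some r]) ++ [:: Some q; Some q]
  ++ [:: Some B'; Some p] ++ up y ++ [:: Some B'; Some r] ++ up z.
pose w5 := (up x ++ [:: Some p]) ++ [:: Some r; Some B'] ++ ([:: Some p] ++ up y)
  ++ [:: Some B'; Some r] ++ up z.
pose w6 := up x ++ [:: Some p; Some p] ++ up y ++ up z.
(* Validity of every stage is needed to chain the equivalences. Up to permutation, consecutive
   stages agree or differ by inserted or deleted pairs. *)
have v1 : valid k w1.
  have pm : perm_eq ([:: Some p; Some p] ++ [:: Some q; Some q] ++ w0) w1.
    by apply/permP => f; rewrite !count_cat /=; lia.
  apply: valid_perm pm _; apply: valid_ins; last apply: valid_ins v0.
    by rewrite /w0 !(mem_cat, inE) !negb_or !new.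
  by rewrite /w0 !(mem_cat, inE) !negb_or !new.
have v2 : valid k w2.
  have pm : perm_eq ([:: Some r; Some r] ++ [:: Some s; Some s] ++ w1) w2.
    by apply/permP => f; rewrite !count_cat /=; lia.
  apply: valid_perm pm _; apply: valid_ins; last apply: valid_ins v1.
    by rewrite /w1 !(mem_cat, inE) !negb_or !new.
  by rewrite /w1 !(mem_cat, inE) !negb_or !new.
have v3 : valid k w3.
  by apply: valid_perm v2; apply/permP => f; rewrite !count_cat /=; lia.
have v4 : valid k w4.
  apply: (@valid_del k _ A'); apply: (@valid_del k _ s).
  by apply: valid_perm v3; apply/permP => f; rewrite !count_cat /=; lia.
have v5 : valid k w5.
  apply: (@valid_del k _ q).
  by apply: valid_perm v4; apply/permP => f; rewrite !count_cat /=; lia.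
have v6 : valid k w6.
  apply: (@valid_del k _ r); apply: (@valid_del k _ B').
  by apply: valid_perm v5; apply/permP => f; rewrite !count_cat /=; lia.
have v7 : valid k (up x ++ up y ++ up z).
  apply: (@valid_del k _ p).
  by apply: valid_perm v6; apply/permP => f; rewrite !count_cat /=; lia.
have e10 : equivalent tau k labT w1 w0 by exact: equivalent2.
have e21 : equivalent tau k labT w2 w1.
  have := @equivalent2 _ tau k _ labT r s (up x ++ [:: Some p])
    ([:: Some q; Some A'; Some B'; Some q; Some p] ++ up y ++ [:: Some A'; Some B']) (up z) lAB.
  by rewrite /w2 /w1 -!catA /=.
have e32 : equivalent tau k labT w3 w2 by apply: equivalent3.
have e34 : equivalent tau k labT w3 w4.
  have := @equivalent2 _ tau k _ labT s A' (up x ++ [:: Some p; Some r; Some q])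
    ([:: Some q; Some B'; Some p] ++ up y) ([:: Some B'; Some r] ++ up z) lBA.
  by rewrite /w3 /w4 -!catA /=.
have e45 : equivalent tau k labT w4 w5.
  have := @equivalent1 _ tau k _ labT q (up x ++ [:: Some p; Some r])
     ([:: Some B'; Some p] ++ up y ++ [:: Some B'; Some r] ++ up z).
  by rewrite /w4 /w5 -!catA /=.
have e56 : equivalent tau k labT w5 w6.
  have := @equivalent2 _ tau k _ labT r B' (up x ++ [:: Some p])
    ([:: Some p] ++ up y) (up z) lAB.
  by rewrite /w5 /w6 -!catA /=.
have e67 : equivalent tau k labT w6 (up x ++ up y ++ up z) by exact: equivalent1.
have e07 : equivalent tau k labT w0 (up x ++ up y ++ up z).
  apply: (equivalent_trans k_gt0 v1 (equivalent_sym e10)).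
  apply: (equivalent_trans k_gt0 v2 (equivalent_sym e21)).
  apply: (equivalent_trans k_gt0 v3 (equivalent_sym e32)).
  apply: (equivalent_trans k_gt0 v4 e34).
  apply: (equivalent_trans k_gt0 v5 e45).
  exact: (equivalent_trans k_gt0 v6 e56 e67).
have [Q [h sz]] := reduce rP v7 e07.
by exists Q; split=> //; move: sz; rewrite !size_cat /=; lia.
Qed.

End Reduction.

(** * Homotopy invariants *)

Section Linking.
Variables (alpha : finType) (tau : alpha -> alpha).
Hypothesis tauK : involutive tau.

(* The coefficients are taken in Z/6 so that fixed points of tau get charge of
   order 2, and [charge a + charge a] still determines the other labels. *)
Definition charge (a : alpha) : {ffun alpha -> 'Z_6} :=
  [ffun x => if x == a then (if tau a == a then 3 else 1)
             else if x == tau a then -1 else 0]%R.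

Lemma charge_neq0 a : (charge a != 0)%R.
Proof. by apply/eqP => /ffunP/(_ a); rewrite !ffunE eqxx; case: ifP. Qed.

(** Evaluation at [a] suffices. The left side is 1 or 3; for [b] other than [a] the right side is 0,
    or -1 if a = tau(b), in which case the left side is 1. *)
Lemma charge_inj : injective charge.
Proof.
move=> a b /ffunP/(_ a); rewrite !ffunE eqxx.
case: (eqVneq a b) => // _; case: (eqVneq a (tau b)) => [->|_]; last by case: ifP.
by rewrite tauK; case: (eqVneq b (tau b)) => // ->; rewrite tauK eqxx.
Qed.

Lemma charge_tau a : (charge (tau a) = - charge a)%R.
Proof.
apply/ffunP => x; rewrite !ffunE tauK (eq_sym a).
case: (eqVneq (tau a) a) => [->|ta]; first by case: (x == a); apply/eqP.
case: (eqVneq x (tau a)) => [->|_]; first by rewrite (negPf ta) opprK.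
by case: ifP; rewrite ?oppr0.
Qed.

(** At [a] the left side is 2, which in Z/6 differs from 0 and from -2; in Z/4 it would equal -2. *)
Lemma charge_double a b : tau a != a -> tau b != b ->
  (charge a + charge a = charge b + charge b)%R -> a = b.
Proof.
move=> /negPf ta /negPf tb /ffunP/(_ a); rewrite !ffunE eqxx ta tb.
by case: (eqVneq a b) => // _; case: (a == tau b).
Qed.

Lemma charge_add_neq0 a b : a <> tau b -> (charge a + charge b != 0)%R.
Proof. by rewrite addr_eq0 -charge_tau => ab; apply/eqP => /charge_inj. Qed.

(* Component and parity of the position in the whole phrase of each occurrence
   of the letter, the first position having parity [b]. *)
Definition places (T : eqType) : bool -> seq (nat * T) -> T -> seq (nat * bool) :=
  fix places b E A := if E is (i, B) :: E' then
      if B == A then (i, b) :: places (~~ b) E' A else places (~~ b) E' A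
    else [::].

(** [None] stands both for the ignored triple and for a letter that does not occur. *)
Definition chord (ps : seq (nat * bool)) : option (nat * nat * bool) :=
  if ps is [:: (i, b); (j, c)] then
    if (i == j) && (b (+) c) then None else Some (i, j, b (+) c)
  else None.

Definition linking (T : finType) (labT : T -> alpha) (E : seq (nat * T))
    (c : nat * nat * bool) :=
  (\sum_(A | chord (places false E A) == Some c) charge (labT A))%R.

Lemma places_cat (T : eqType) b (X Y : seq (nat * T)) A :
  places b (X ++ Y) A = places b X A ++ places (b (+) odd (size X)) Y A.
Proof.
elim: X b => [|[i B] X IH] b /=; first by rewrite addbF.
by rewrite IH addNb addbN; case: ifP.
Qed.

Lemma places_nil (T : eqType) b (X : seq (nat * T)) A : A \notin unzip2 X ->
  places b X A = [::].
Proof.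
by elim: X b => [|[i B] X IH] b //=; rewrite inE eq_sym => /norP[/negPf-> /IH].
Qed.

Lemma places_map (T T' : eqType) (f : T -> T') b (X : seq (nat * T)) A :
  injective f -> places b [seq (e.1, f e.2) | e <- X] (f A) = places b X A.
Proof. by move=> fI; elim: X b => [|[i B] X IH] b //=; rewrite inj_eq // IH. Qed.

Lemma linking_map (T T' : finType) (labT : T -> alpha) (labT' : T' -> alpha)
    (f : T -> T') E c : injective f -> (forall A, labT' (f A) = labT A) ->
  linking labT' [seq (e.1, f e.2) | e <- E] c = linking labT E c.
Proof.
move=> fI fl; rewrite /linking (bigID (mem (codom f))) /=.
(* A letter outside the image of [f] has no places, so its chord is [None] and it contributes
   nothing. *)
rewrite [X in (_ + X)%R]big1 ?addr0; last first.
  move=> A /andP[+ /negP nA]; rewrite places_nil // /unzip2 -map_comp.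
  by apply/mapP => -[e _ /= eA]; case: nA; rewrite eA codom_f.
under eq_bigl => A do rewrite andbC.
rewrite big_mkcondr -big_uniq ?(map_inj_uniq fI) ?enum_uniq //= big_image /=.
rewrite [RHS]big_mkcond; apply: eq_bigr => A _.
by rewrite places_map // fl.
Qed.

Lemma eq_linking (T : finType) (labT : T -> alpha) E E' c :
  (forall A, chord (places false E A) = chord (places false E' A)) ->
  linking labT E c = linking labT E' c.
Proof. by move=> e; apply: eq_bigl => A; rewrite e. Qed.

(** The deleted letter has the ignored triple, and the occurrences behind it shift by two places. *)
Lemma linking1 (T : finType) (labT : T -> alpha) A i X Y c :
  A \notin unzip2 (X ++ Y) ->
  linking labT (X ++ [:: (i, A); (i, A)] ++ Y) c = linking labT (X ++ Y) c.
Proof.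
move=> nA; apply: eq_linking => D.
move: nA; rewrite /unzip2 map_cat mem_cat => /norP[nX nY].
rewrite !places_cat /= addbF.
case: eqP => [<-|_] //.
by rewrite !places_nil //= eqxx addbN addbb.
Qed.

(** The distances for [A] and for [B] differ by 2, so the two chords agree while the charges are
    opposite. All other occurrences shift by an even number of places. *)
Lemma linking2 (T : finType) (labT : T -> alpha) A B i j X Y Z c :
  labT B = tau (labT A) -> A != B ->
  A \notin unzip2 (X ++ Y ++ Z) -> B \notin unzip2 (X ++ Y ++ Z) ->
  linking labT (X ++ [:: (i, A); (i, B)] ++ Y ++ [:: (j, B); (j, A)] ++ Z) c
  = linking labT (X ++ Y ++ Z) c.
Proof.
move=> lAB AB nA nB; set E := X ++ _; set E' := X ++ Y ++ Z.
have other D : D != A -> D != B -> places false E D = places false E' D.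
  rewrite ![D == _]eq_sym => /negPf DA /negPf DB.
  by rewrite !places_cat /= DA DB !addbF.
have absent : chord (places false E' A) = None /\ chord (places false E' B) = None.
  by rewrite !places_nil.
have parallel : chord (places false E A) = chord (places false E B).
  move: nA nB; rewrite /unzip2 !map_cat !mem_cat !negb_or => /and3P[a1 a2 a3] /and3P[b1 b2 b3].
  rewrite !places_cat /= !eqxx (negPf AB) eq_sym (negPf AB) !places_nil //=.
  by case: (odd (size X)); case: (odd (size Y)).
rewrite /linking big_mkcond [RHS]big_mkcond (bigD1 A) // (bigD1 B) 1?eq_sym //=.
rewrite [RHS](bigD1 A) // [in RHS](bigD1 B) 1?eq_sym //=.
case: absent => -> ->; rewrite !add0r addrA parallel lAB charge_tau.
case: eqP => _; rewrite ?subrr ?addr0 add0r;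
  by apply: eq_bigr => D /andP[DA DB]; rewrite other.
Qed.

Lemma linking3 (T : finType) (labT : T -> alpha) A B C i j l X Y Z W c :
  uniq [:: A; B; C] -> (forall D, D \in [:: A; B; C] -> D \notin unzip2 (X ++ Y ++ Z ++ W)) ->
  linking labT (X ++ [:: (i, A); (i, B)] ++ Y ++ [:: (j, A); (j, C)] ++ Z
    ++ [:: (l, B); (l, C)] ++ W) c
  = linking labT (X ++ [:: (i, B); (i, A)] ++ Y ++ [:: (j, C); (j, A)] ++ Z
    ++ [:: (l, C); (l, B)] ++ W) c.
Proof.
move=> /and3P[]; rewrite !inE negb_or => /andP[AB AC] BC _ nABC; apply: eq_linking => D.
rewrite !places_cat.
have [DABC|] := boolP (D \in [:: A; B; C]); last first.
  rewrite !inE !negb_or ![D == _]eq_sym => /and3P[/negPf DA /negPf DB /negPf DC].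
  by rewrite /= DA DB DC.
have := nABC D DABC; rewrite /unzip2 !map_cat !mem_cat !negb_or => /and4P[DX DY DZ DW].
rewrite !(places_nil _ DX) !(places_nil _ DY) !(places_nil _ DZ) !(places_nil _ DW).
have /negPf BA : B != A by rewrite eq_sym.
have /negPf CA : C != A by rewrite eq_sym.
have /negPf CB : C != B by rewrite eq_sym.
move/negPf: AB => AB; move/negPf: AC => AC; move/negPf: BC => BC.
by move: DABC; rewrite !inE => /or3P[]/eqP->;
  rewrite /= !eqxx ?(AB, AC, BC, BA, CA, CB) /= ?eqxx ?(AB, AC, BC, BA, CA, CB) /=;
  case: (odd (size X)); case: (odd (size Y)); case: (odd (size Z)).
Qed.

(* Left multiplication by [a] on reduced words of the group generated by alpha
   with tau(a) = a^-1. *)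
Definition push (a : alpha) (r : seq alpha) : seq alpha :=
  if r is b :: r' then if b == tau a then r' else a :: r else [:: a].

Definition reduced := sorted (fun a b => b != tau a).

Lemma push_reduced a r : reduced r -> reduced (push a r).
Proof.
case: r => // b r /=; case: ifP => [_|/negbT ba] br; first exact: path_sorted br.
by rewrite /= ba.
Qed.

(** Reducedness matters when a leading [a] was cancelled: the letter after it is not [tau a], so
    pushing [a] back does not cancel. *)
Lemma pushK a r : reduced r -> push a (push (tau a) r) = r.
Proof.
case: r => [|b r] /=; first by rewrite eqxx.
rewrite tauK; case: eqP => [->|_] /=; last by rewrite eqxx.
by case: r => //= d r /andP[/negPf-> _].
Qed.

Lemma pushK' a r : reduced r -> push (tau a) (push a r) = r.
Proof. by move=> rr; rewrite -{2}(tauK a) pushK. Qed.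

(** With two occurrences per letter, an occurrence is the first one exactly when the letter still
    appears in the tail. *)
Fixpoint gamma (T : eqType) (labT : T -> alpha) (c : nat) (E : seq (nat * T)) : seq alpha :=
  if E is (i, A) :: E' then
    if i == c then
      push (if A \in unzip2 E' then labT A else tau (labT A)) (gamma labT c E')
    else gamma labT c E'
  else [::].

Lemma gamma_reduced (T : eqType) (labT : T -> alpha) c E : reduced (gamma labT c E).
Proof. by elim: E => [|[i A] E IH] //=; case: ifP => // _; apply: push_reduced. Qed.

Lemma gamma_map (T T' : eqType) (labT : T -> alpha) (labT' : T' -> alpha)
    (f : T -> T') E c : injective f -> (forall A, labT' (f A) = labT A) ->
  gamma labT' c [seq (e.1, f e.2) | e <- E] = gamma labT c E.
Proof.
move=> fI fl; elim: E => [|[i A] E IH] //=; rewrite IH fl.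
by rewrite /unzip2 -!map_comp (map_comp f snd) mem_map.
Qed.

(** The reading of [X] consults the tail only to learn which letters of [X] recur there. *)
Lemma gamma_cat (T : eqType) (labT : T -> alpha) c (X Y Y' : seq (nat * T)) :
  {in unzip2 X, unzip2 Y =i unzip2 Y'} -> gamma labT c Y = gamma labT c Y' ->
  gamma labT c (X ++ Y) = gamma labT c (X ++ Y').
Proof.
move=> + e; elim: X => [|[i A] X IH] //= XY; rewrite IH; last first.
  by move=> B BX; apply: XY; rewrite inE BX orbT.
by rewrite /unzip2 !map_cat !mem_cat XY ?inE ?eqxx.
Qed.

Lemma gamma1 (T : finType) (labT : T -> alpha) A i X Y c :
  A \notin unzip2 (X ++ Y) ->
  gamma labT c (X ++ [:: (i, A); (i, A)] ++ Y) = gamma labT c (X ++ Y).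
Proof.
rewrite /unzip2 map_cat mem_cat => /norP[nX nY]; apply: gamma_cat.
  by move=> D DX; rewrite !inE; case: eqP DX => // ->; rewrite (negPf nX).
by rewrite /= mem_head (negPf nY); case: (i == c); rewrite ?pushK ?gamma_reduced.
Qed.

(** Each displayed pair cancels by itself: the first reads |A| tau(|A|), and so does the second,
    since tau(|B|) = |A|. *)
Lemma gamma2 (T : finType) (labT : T -> alpha) A B i j X Y Z c :
  labT B = tau (labT A) -> A != B ->
  A \notin unzip2 (X ++ Y ++ Z) -> B \notin unzip2 (X ++ Y ++ Z) ->
  gamma labT c (X ++ [:: (i, A); (i, B)] ++ Y ++ [:: (j, B); (j, A)] ++ Z)
  = gamma labT c (X ++ Y ++ Z).
Proof.
move=> lAB AB; rewrite /unzip2 !map_cat !mem_cat !negb_or.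
move=> /and3P[aX aY aZ] /and3P[bX bY bZ]; apply: gamma_cat.
  move=> D DX; rewrite /unzip2 !map_cat !inE !mem_cat !inE.
  have /negPf-> : D != A by apply: contraNneq aX => <-.
  by have /negPf-> : D != B by apply: contraNneq bX => <-.
have -> : gamma labT c ([:: (i, A); (i, B)] ++ Y ++ [:: (j, B); (j, A)] ++ Z)
    = gamma labT c (Y ++ [:: (j, B); (j, A)] ++ Z).
  rewrite /= /unzip2 !map_cat /= !inE !mem_cat !inE !eqxx !orbT lAB.
  by case: (i == c); rewrite ?pushK ?gamma_reduced.
apply: gamma_cat.
  move=> D DY; rewrite /= !inE.
  have /negPf-> : D != A by apply: contraNneq aY => <-.
  by have /negPf-> : D != B by apply: contraNneq bY => <-.
rewrite /= inE [B == A]eq_sym (negPf AB) (negPf aZ) (negPf bZ) lAB tauK.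
by case: (j == c); rewrite ?pushK ?gamma_reduced.
Qed.

(** With common label a, the outer pairs read a a and tau(a) tau(a), unchanged by the swap; the
    middle pair reads tau(a) a or a tau(a), trivial either way. *)
Lemma gamma3 (T : finType) (labT : T -> alpha) A B C i j l X Y Z W c :
  labT A = labT B -> labT B = labT C ->
  uniq [:: A; B; C] -> (forall D, D \in [:: A; B; C] -> D \notin unzip2 (X ++ Y ++ Z ++ W)) ->
  gamma labT c (X ++ [:: (i, A); (i, B)] ++ Y ++ [:: (j, A); (j, C)] ++ Z
    ++ [:: (l, B); (l, C)] ++ W)
  = gamma labT c (X ++ [:: (i, B); (i, A)] ++ Y ++ [:: (j, C); (j, A)] ++ Z
    ++ [:: (l, C); (l, B)] ++ W).
Proof.
move=> lAB lBC /and3P[]; rewrite !inE negb_or => /andP[AB AC] BC _ nABC.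
have [aX aY aZ aW] : [/\ A \notin unzip2 X, A \notin unzip2 Y,
    A \notin unzip2 Z & A \notin unzip2 W].
  have := nABC A; rewrite mem_head /unzip2 !map_cat !mem_cat !negb_or => /(_ isT).
  by case/and4P.
have [bX bY bZ bW] : [/\ B \notin unzip2 X, B \notin unzip2 Y,
    B \notin unzip2 Z & B \notin unzip2 W].
  have := nABC B; rewrite !inE eqxx orbT /unzip2 !map_cat !mem_cat !negb_or => /(_ isT).
  by case/and4P.
have [cX cY cZ cW] : [/\ C \notin unzip2 X, C \notin unzip2 Y,
    C \notin unzip2 Z & C \notin unzip2 W].
  have := nABC C; rewrite !inE eqxx !orbT /unzip2 !map_cat !mem_cat !negb_or => /(_ isT).
  by case/and4P.
have CB := BC; rewrite eq_sym in CB.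
apply: gamma_cat.
  by move=> D DX; rewrite /unzip2 !map_cat /= !(inE, mem_cat);
    case: (D == A); case: (D == B); case: (D == C); rewrite ?orbT.
set U := Y ++ _; set V := Y ++ _.
have -> : gamma labT c ([:: (i, A); (i, B)] ++ U) =
    gamma labT c ([:: (i, B); (i, A)] ++ U).
  by rewrite /= /unzip2 !map_cat /= !(inE, mem_cat) !eqxx !orbT lAB.
suff UV : gamma labT c U = gamma labT c V.
  by rewrite /= UV /unzip2 !map_cat /= !(inE, mem_cat) !eqxx !orbT.
apply: gamma_cat.
  by move=> D DX; rewrite /unzip2 !map_cat /= !(inE, mem_cat);
    case: (D == A); case: (D == B); case: (D == C); rewrite ?orbT.
have E : gamma labT c (Z ++ [:: (l, B); (l, C)] ++ W) =
    gamma labT c (Z ++ [:: (l, C); (l, B)] ++ W).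
  apply: gamma_cat.
    by move=> D DX; rewrite /= !inE; case: (D == A); case: (D == B); case: (D == C); rewrite ?orbT.
  by rewrite /= !inE (negPf BC) (negPf CB) (negPf bW) (negPf cW) lBC.
rewrite /= E /unzip2 !map_cat /= !(inE, mem_cat) !eqxx !orbT.
rewrite (negPf AB) (negPf AC) (negPf aZ) (negPf aW) /= lAB lBC.
by case: (j == c); rewrite ?pushK' ?pushK ?gamma_reduced.
Qed.

End Linking.

(** * Invariance under homotopy *)

Section Invariance.
Variables (alpha : finType) (tau : alpha -> alpha) (k : nat).
Hypothesis tauK : involutive tau.
Implicit Types P Q : nanophrase alpha k.

Definition same_invariants (T T' : finType) (labT : T -> alpha) (labT' : T' -> alpha)
    (s : seq (option T)) (s' : seq (option T')) : Prop :=
  (forall c, linking tau labT (occs 0 s) c = linking tau labT' (occs 0 s') c) /\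
  (forall c, gamma tau labT c (occs 0 s) = gamma tau labT' c (occs 0 s')).

Lemma same_invariants_map P Q (f : Q -> P) : injective f -> lab_preserving f ->
  same_invariants (@lab _ _ P) (@lab _ _ Q) (map (omap f) (phrase Q)) (phrase Q).
Proof.
by move=> fI fl; split=> c; rewrite occs_map; [apply: linking_map | apply: gamma_map].
Qed.

Lemma same_invariants_trans (T T' T'' : finType) (l : T -> alpha) (l' : T' -> alpha)
    (l'' : T'' -> alpha) s s' s'' :
  same_invariants l l' s s' -> same_invariants l' l'' s' s'' ->
  same_invariants l l'' s s''.
Proof. by move=> [a b] [c d]; split=> i; rewrite ?a ?b. Qed.

Lemma mem_occs (T : eqType) n (s : seq (option T)) A :
  (A \in unzip2 (occs n s)) = (Some A \in s).
Proof. by rewrite -!has_pred1 !has_count count_occs. Qed.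

Lemma step_invariants P Q : step tau P Q ->
  same_invariants (@lab _ _ P) (@lab _ _ Q) (phrase P) (phrase Q).
Proof.
have vP := realizes_valid (realizes_phrase P).
case.
- case=> f [fB fl e]; have fI := bij_inj fB.
  have -> : phrase Q = map (omap f) (phrase P).
    rewrite -barred_map; congr barred.
    have -> : words Q = map_tuple (map f) (words P).
      by apply: eq_from_tnth => i; rewrite tnth_map.
    by [].
  have [a b] := same_invariants_map fI fl.
  by split=> c; rewrite ?a ?b.
- case=> A [f [x [y [[fI fl] _ eP eQ]]]].
  (* [Q] is replaced by its image under [f], so that both sequences are written in the letters of
     [P]. *)
  apply: same_invariants_trans (same_invariants_map fI fl); rewrite eQ eP.
  rewrite eP in vP; have /(valid_rem vP) nA :
      perm_eq (x ++ [:: Some A; Some A] ++ y) ([:: Some A; Some A] ++ x ++ y).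
    by rewrite perm_catCA.
  have E : occs 0 (x ++ y) = occs 0 x ++ occs (nbars x) y by rewrite occs_cat.
  have E' : occs 0 (x ++ [:: Some A; Some A] ++ y) =
      occs 0 x ++ [:: (nbars x, A); (nbars x, A)] ++ occs (nbars x) y.
    by rewrite !occs_cat /= !addn0 add0n.
  rewrite -(mem_occs 0) E in nA.
  by split=> c; rewrite E E'; [apply: linking1 | apply: gamma1].
- case=> A [B [f [x [y [z [lAB [fI fl] _ eP eQ]]]]]].
  apply: same_invariants_trans (same_invariants_map fI fl); rewrite eQ eP.
  rewrite eP in vP; set s := (X in valid _ X) in vP.
  have pmA : perm_eq s ([:: Some A; Some A] ++ [:: Some B; Some B] ++ x ++ y ++ z).
    by apply/permP => p; rewrite !count_cat /=; lia.
  have pmB : perm_eq s ([:: Some B; Some B] ++ [:: Some A; Some A] ++ x ++ y ++ z).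
    by apply/permP => p; rewrite !count_cat /=; lia.
  have := valid_rem vP pmA; rewrite mem_cat !inE !orbb => /norP[AB nA].
  have := valid_rem vP pmB; rewrite mem_cat !inE !orbb => /norP[_ nB].
  rewrite (inj_eq (@Some_inj _)) in AB.
  have E : occs 0 (x ++ y ++ z) = occs 0 x ++ occs (nbars x) y ++ occs (nbars x + nbars y) z.
    by rewrite !occs_cat.
  have E' : occs 0 s = occs 0 x ++ [:: (nbars x, A); (nbars x, B)] ++ occs (nbars x) y ++
      [:: (nbars x + nbars y, B); (nbars x + nbars y, A)] ++ occs (nbars x + nbars y) z.
    by rewrite !occs_cat /= !addn0 !add0n.
  rewrite -(mem_occs 0) E in nA; rewrite -(mem_occs 0) E in nB.
  by split=> c; rewrite E E'; [apply: linking2 | apply: gamma2].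
- case=> A [B [D [f [x [y [z [t [[lAB lBD] [fB fl] eP eQ]]]]]]]].
  have fI := bij_inj fB.
  apply: same_invariants_trans (same_invariants_map fI fl); rewrite eQ eP.
  rewrite eP in vP; set s := (X in valid _ X) in vP.
  pose AA := [:: Some A; Some A]; pose BB := [:: Some B; Some B]; pose DD := [:: Some D; Some D].
  have pmA : perm_eq s (AA ++ BB ++ DD ++ x ++ y ++ z ++ t).
    by apply/permP => p; rewrite !count_cat /=; lia.
  have pmB : perm_eq s (BB ++ AA ++ DD ++ x ++ y ++ z ++ t).
    by apply/permP => p; rewrite !count_cat /=; lia.
  have pmD : perm_eq s (DD ++ BB ++ AA ++ x ++ y ++ z ++ t).
    by apply/permP => p; rewrite !count_cat /=; lia.
  have := valid_rem vP pmA; rewrite !(mem_cat (_ : option P)) !inE !orbb => /norP[AB /norP[AD nA]].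
  have := valid_rem vP pmB; rewrite !(mem_cat (_ : option P)) !inE !orbb => /norP[_ /norP[BD nB]].
  have := valid_rem vP pmD; rewrite !(mem_cat (_ : option P)) !inE !orbb => /norP[_ /norP[_ nD]].
  have U : uniq [:: A; B; D].
    by move: AB AD BD; rewrite /= !inE !(inj_eq (@Some_inj _)) negb_or => -> -> ->.
  pose i := nbars x; pose j := i + nbars y; pose l := j + nbars z.
  have E u1 u2 v1 v2 w1 w2 : occs 0 (x ++ [:: Some u1; Some u2] ++ y ++ [:: Some v1; Some v2] ++ z
        ++ [:: Some w1; Some w2] ++ t) =
      occs 0 x ++ [:: (i, u1); (i, u2)] ++ occs i y ++ [:: (j, v1); (j, v2)] ++ occs j z
        ++ [:: (l, w1); (l, w2)] ++ occs l t.
    by rewrite !occs_cat /= !addn0 !add0n.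
  have nABD C : C \in [:: A; B; D] ->
      C \notin unzip2 (occs 0 x ++ occs i y ++ occs j z ++ occs l t).
    have -> : occs 0 x ++ occs i y ++ occs j z ++ occs l t = occs 0 (x ++ y ++ z ++ t).
      by rewrite !occs_cat.
    by rewrite mem_occs !mem_cat !inE => /or3P[]/eqP->.
  by split=> c; rewrite !E; [apply: linking3 | apply: gamma3].
Qed.

Lemma homotopic_invariants P Q : homotopic tau P Q ->
  same_invariants (@lab _ _ P) (@lab _ _ Q) (phrase P) (phrase Q).
Proof.
elim=> {P Q} [P Q /step_invariants//|//|P Q _ [a b]|P Q R _ h1 _ h2].
  by split.
exact: same_invariants_trans h1 h2.
Qed.

End Invariance.

(** * Comparison of the fourteen types *)

(** The occurrences of P^{X;Y}, with positions as plain numbers so that types can be compared by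
    arithmetic. *)
Definition pattern_occs (X : ptype) (ps : seq nat) : seq (nat * bool) :=
  flatten [seq [seq (e.1, l) | l <- e.2] | e <- zip ps (pattern X)].

Definition pattern_chord X ps l := chord (places false (pattern_occs X ps) l).

Definition positionable X ps := (size ps == size (pattern X)) && sorted ltn ps.

(** A letter lying twice in one component arises only within ABAB, ABA and BAB, at distance 2, so
    the ignored triple does not appear. *)
Lemma pattern_chord_total X ps l : positionable X ps -> pattern_chord X ps l <> None.
Proof.
rewrite /pattern_chord /chord.
case: X; move: ps => [|p [|q [|r [|s [|? ?]]]]] //=; rewrite /positionable /pattern_occs /=;
  case: l => //= H; rewrite ?andbF //; case: ifP => //; lia.
Qed.

Ltac compare_patterns :=
  intros; repeat match goal with
  | [ H : context [if ?b then _ else _] |- _ ] => destruct b eqn:?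
  end; try discriminate; repeat match goal with
  | [ H : Some _ = Some _ |- _ ] => case: H; intros
  end; try discriminate; subst; first [by [] | exfalso; lia].

(** The components separate the types, except I from II in (2,2), (2,1,1), (1,2,1) and (1,1,2),
    where the parity decides. *)
Lemma pattern_chord_inj X X' ps ps' : positionable X ps -> positionable X' ps' ->
  (forall l, pattern_chord X ps l = pattern_chord X' ps' l) -> X = X' /\ ps = ps'.
Proof.
move=> + + e; move: (e true) (e false) => {e}; rewrite /pattern_chord /chord.
case: X; move: ps => [|p [|q [|r [|s [|? ?]]]]] //=;
  rewrite /positionable /pattern_occs //= ?andbF;
case: X'; move: ps' => [|p' [|q' [|r' [|s' [|? ?]]]]] //=;
  rewrite ?andbF ?andbT; compare_patterns.
Qed.

(** In every pattern the components of A come lexicographically before those of B or equal them, so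
    an exchange forces equality. Equal components occur only in types 4, (2,2I) and (2,2II), where
    the parities agree too. *)
Lemma pattern_chord_swap X X' ps ps' : positionable X ps -> positionable X' ps' ->
  (forall l, pattern_chord X ps l = pattern_chord X' ps' (~~ l)) ->
  pattern_chord X ps true = pattern_chord X ps false.
Proof.
move=> + + e; move: (e true) (e false) => {e}; rewrite /pattern_chord /chord.
case: X; move: ps => [|p [|q [|r [|s [|? ?]]]]] //=;
  rewrite /positionable /pattern_occs //= ?andbF;
case: X'; move: ps' => [|p' [|q' [|r' [|s' [|? ?]]]]] //=;
  rewrite ?andbF ?andbT; compare_patterns.
Qed.

(** * The invariants of the listed nanophrases *)

Section NanoP.
Variables (alpha : finType) (tau : alpha -> alpha) (k : nat).

Lemma positions_positionable X (Y : positions k X) : positionable X [seq val i | i <- pos Y].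
Proof. by rewrite /positionable size_map pos_size pos_sorted. Qed.

Lemma filter_positions X (Y : positions k X) : [seq i <- enum 'I_k | i \in pos Y] = pos Y.
Proof.
have sE : sorted ltn (map val (enum 'I_k)) by rewrite val_enum_ord iota_ltn_sorted.
have := pos_sorted Y; rewrite sorted_map => sY; rewrite sorted_map in sE.
apply: (irr_sorted_eq (leT := relpre val ltn)) => //.
- by move=> i j l; apply: ltn_trans.
- by move=> i; apply: ltnn.
- by apply: sorted_filter sE => i j l; apply: ltn_trans.
- by move=> i; rewrite mem_filter mem_enum andbT.
Qed.

Lemma occs_nanoP X (Y : positions k X) (a b : alpha) :
  occs 0 (phrase (nanoP Y a b)) = pattern_occs X [seq val i | i <- pos Y].
Proof.
rewrite occs_barred size_tuple -val_enum_ord.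
pose G (i : 'I_k) := [seq (val i, l) | l <- nth [::] (pattern X) (index i (pos Y))].
transitivity (flatten [seq G i | i <- enum 'I_k]).
  by rewrite /= /G; elim: (enum 'I_k) => //= i s ->.
(* Components that are not positions are empty and drop out; the others stay in increasing order. *)
transitivity (flatten [seq G i | i <- enum 'I_k & i \in pos Y]).
  elim: (enum 'I_k) => //= i s ->; case: ifP => // /negbT iY.
  by rewrite /G nth_default // -(eqP (pos_size Y)) leqNgt index_mem.
have uY : uniq (pos Y).
  by have := sorted_uniq ltn_trans ltnn (pos_sorted Y); rewrite map_inj_uniq //; apply: val_inj.
rewrite filter_positions /pattern_occs; congr flatten.
have sY := eqP (pos_size Y).
apply: (@eq_from_nth _ [::]); first by rewrite !size_map size_zip size_map sY minnn.
move=> n; rewrite size_map => nY; pose i0 := tnth (in_tuple (pos Y)) (Ordinal nY).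
rewrite (nth_map i0) // (nth_map (0, [::])); last by rewrite size_zip size_map sY minnn -sY.
by rewrite nth_zip ?size_map //= (nth_map i0) // /G index_uniq.
Qed.

Definition nanoP_lab (a b : alpha) (c : bool) := if c then a else b.

Lemma linking_pattern a b X ps c :
  linking tau (nanoP_lab a b) (pattern_occs X ps) c =
  ((if pattern_chord X ps true == Some c then charge tau a else 0) +
   (if pattern_chord X ps false == Some c then charge tau b else 0))%R.
Proof. by rewrite /linking big_mkcond big_bool. Qed.

Lemma two_terms_neq0 (V : zmodType) (C : eqType) (x y c : C) (u v : V) :
  (u != 0 -> v != 0 -> (x = y -> u + v != 0) ->
  ((if x == c then u else 0) + (if y == c then v else 0) != 0) = (c \in [:: x; y]))%R.
Proof.
move=> u0 v0 uv; rewrite !inE [c == x]eq_sym [c == y]eq_sym.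
case: (eqVneq x c) => xc; case: (eqVneq y c) => yc; rewrite ?addr0 ?add0r ?eqxx ?u0 //.
by rewrite uv // xc.
Qed.

(** For two point masses that do not cancel, the support of the sum is {x, y}; equal sums thus have
    the same points up to exchange. *)
Lemma two_terms (V : zmodType) (C : eqType) (x y x' y' : C) (u v u' v' : V) :
  (u != 0 -> v != 0 -> u' != 0 -> v' != 0 ->
  (x = y -> u + v != 0) -> (x' = y' -> u' + v' != 0) ->
  (forall c, (if x == c then u else 0) + (if y == c then v else 0) =
             (if x' == c then u' else 0) + (if y' == c then v' else 0)) ->
  [/\ x = x', y = y' & if x == y then u + v = u' + v' else u = u' /\ v = v'] \/
  [/\ x = y', y = x' & x <> y])%R.
Proof.
move=> u0 v0 u0' v0' uv uv' e.
have mem c : (c \in [:: x; y]) = (c \in [:: x'; y']).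
  by rewrite -(two_terms_neq0 c u0 v0 uv) e two_terms_neq0.
have := mem x; have := mem y; have := mem x'; have := mem y'.
rewrite !inE !eqxx ?orbT => /orP[]/eqP Ey /orP[]/eqP Ex; subst y' x'; rewrite ?eqxx ?orbT ?orbb.
- move=> /esym/eqP yx _; subst y; left; split=> //; rewrite eqxx.
  by have := e x; rewrite !eqxx.
- have [xy|xy] := eqVneq x y; last by right; split=> //; apply/eqP.
  by subst y; left; split=> //; have := e x; rewrite !eqxx.
- move=> _ _; left; split=> //; have := e x; have := e y; rewrite !eqxx.
  by rewrite eq_sym; case: eqP => // _; rewrite !addr0 !add0r.
- move=> _ /= /esym/eqP xy; subst y; left; split=> //; rewrite eqxx.
  by have := e x; rewrite !eqxx.
Qed.

Hypothesis tauK : involutive tau.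

(** The two chords agree only in the three types for which admissibility is the condition a ≠
    tau(b). *)
Lemma admissible_chord X ps (a b : alpha) : positionable X ps ->
  pattern_chord X ps true = pattern_chord X ps false ->
  admissible tau X a b -> a <> tau b.
Proof.
rewrite /pattern_chord /chord.
by case: X; move: ps => [|p [|q [|r [|s [|? ?]]]]] //=;
  rewrite /positionable /pattern_occs //= ?andbF; compare_patterns.
Qed.

(** In types (2,2I) and (2,2II) component [p] reads the reduced word ab. In type 4 it reads the
    commutator of a and b, which is reduced unless a = b; if both commutators are trivial, the
    doubled charges decide, as tau(a) ≠ a by admissibility. *)
Lemma gamma_pattern_inj X ps a b a' b' : positionable X ps ->
  pattern_chord X ps true = pattern_chord X ps false ->
  admissible tau X a b -> admissible tau X a' b' ->
  (charge tau a + charge tau b = charge tau a' + charge tau b')%R ->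
  (forall c, gamma tau (nanoP_lab a b) c (pattern_occs X ps) =
             gamma tau (nanoP_lab a' b') c (pattern_occs X ps)) ->
  a = a' /\ b = b'.
Proof.
move=> okX e adm adm' ch g.
have /eqP/negPf ab := admissible_chord okX e adm.
have /eqP/negPf ab' := admissible_chord okX e adm'.
have ba c d : (c == tau d) = false -> (d == tau c) = false.
  by move=> cd; rewrite -[d]tauK (inj_eq (inv_inj tauK)) eq_sym.
have := ba _ _ ab; have := ba _ _ ab' => ba1' ba1.
have pair p q : p < q ->
    gamma tau (nanoP_lab a b) p [:: (p, true); (p, false); (q, true); (q, false)] = [:: a; b] /\
    gamma tau (nanoP_lab a' b') p [:: (p, true); (p, false); (q, true); (q, false)] = [:: a'; b'].
  by move=> pq; rewrite /= !eqxx (gtn_eqF pq) /= ba1 ba1'.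
have pair' p q : p < q ->
    gamma tau (nanoP_lab a b) p [:: (p, true); (p, false); (q, false); (q, true)] = [:: a; b] /\
    gamma tau (nanoP_lab a' b') p [:: (p, true); (p, false); (q, false); (q, true)] = [:: a'; b'].
  by move=> pq; rewrite /= !eqxx (gtn_eqF pq) /= ba1 ba1'.
case: X okX e {adm adm'} g;
  case: ps => [|p [|q [|r [|s [|? ?]]]]] //; rewrite /positionable /= ?andbT => okX e g.
- have := g p; rewrite /pattern_occs /= !eqxx /= !tauK ![tau _ == _]eq_sym ab ab' /=.
  rewrite !(inj_eq (inv_inj tauK)).
  case: (eqVneq a b) => [Eab|nab]; case: (eqVneq a' b') => [Eab'|nab'] /=;
    rewrite ?ba1 ?ba1' //=; try subst b; try subst b'; rewrite ?eqxx //; last by case.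
  by move=> _; have /charge_double := ch; rewrite ![tau _ == _]eq_sym ab ab' => /(_ isT isT) ->.
all: try by have [E1 E2] := pair _ _ okX; have [] := etrans (etrans (esym E1) (g p)) E2.
all: try by have [E1 E2] := pair' _ _ okX; have [] := etrans (etrans (esym E1) (g p)) E2.
(* In the remaining types the chords of the two letters differ. *)
all: by exfalso; move: e okX;
  rewrite /pattern_chord /chord /pattern_occs /= ?andbF; compare_patterns.
Qed.

Lemma nanoP_homotopic_inj (X X' : ptype) (Y : positions k X) (Y' : positions k X')
    (a b a' b' : alpha) :
  admissible tau X a b -> admissible tau X' a' b' ->
  homotopic tau (nanoP Y a b) (nanoP Y' a' b') ->
  [/\ X = X', pos Y = pos Y', a = a' & b = b'].
Proof.
move=> adm adm' /(homotopic_invariants tauK)[]; rewrite !occs_nanoP.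
have := positions_positionable Y; have := positions_positionable Y'.
set ps := map _ (pos Y); set ps' := map _ (pos Y') => ok' ok L G.
have [||||||||] := @two_terms _ _ (pattern_chord X ps true) (pattern_chord X ps false)
  (pattern_chord X' ps' true) (pattern_chord X' ps' false)
  (charge tau a) (charge tau b) (charge tau a') (charge tau b');
  rewrite ?charge_neq0 //.
- by move=> e; apply: charge_add_neq0 => //; apply: admissible_chord ok e adm.
- by move=> e; apply: charge_add_neq0 => //; apply: admissible_chord ok' e adm'.
(* [two_terms] ranges over optional triples; at [None] both sides vanish because every pattern chord
   is a genuine triple. *)
- case=> [c|]; first by have := L c; rewrite !linking_pattern.
  by do !case: eqP => [/pattern_chord_total[]//|_].
- case=> eT eF ch.
  have [EX Eps] : X = X' /\ ps = ps' by apply: pattern_chord_inj => // -[].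
  subst X'; have EY : pos Y = pos Y' by apply: inj_map Eps; apply: val_inj.
  have [-> ->] : a = a' /\ b = b'; last by [].
  case: eqP ch => [e ch|_ [/(charge_inj tauK)-> /(charge_inj tauK)->]] //.
  by apply: gamma_pattern_inj ok e adm adm' ch _ => c; rewrite {2}Eps; apply: G.
case=> eT eF []; apply: (pattern_chord_swap ok ok').
by case.
Qed.

End NanoP.

(** * Classification *)

Lemma occs_bounds (T : Type) n (s : seq (option T)) :
  path leq n (rcons (unzip1 (occs n s)) (n + nbars s)).
Proof.
elim: s n => [|[A|] s IH] n /=; first by rewrite leq_addr.
  by rewrite leqnn; apply: IH.
rewrite /nbars /= -/(nbars s) addnA addn1.
by case: (rcons _ _) (IH n.+1) => //= m r /andP[nm ->]; rewrite ltnW.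
Qed.

Lemma occs_split (T : Type) n (s : seq (option T)) X Y : occs n s = X ++ Y ->
  exists x m y, s = x ++ y /\ occs m y = Y.
Proof.
elim: X n s => [|[i A] X IH] n s; first by move=> e; exists [::], n, s.
move=> h; have [s' -> [_ e]] := occs_consE h; have [x [m [y [-> Ey]]]] := IH _ _ e.
by exists (nseq (i - n) None ++ Some A :: x), m, y; rewrite -catA.
Qed.

(** Equal indices leave no room for a separator, so the two letters form a subword to which a move
    can apply. *)
Lemma occs_pair (T : Type) n (s : seq (option T)) X i A B Y :
  occs n s = X ++ (i, A) :: (i, B) :: Y ->
  exists x y, s = x ++ [:: Some A; Some B] ++ y /\ occs i y = Y.
Proof.
case/occs_split=> [x [m [y [-> h]]]]; have [z -> [_ h']] := occs_consE h.
have [t -> [_ e]] := occs_consE h'.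
exists (x ++ nseq (i - m) None), t; split=> //.
by rewrite subnn -!catA.
Qed.

Section Classification.
Variables (alpha : finType) (tau : alpha -> alpha) (k : nat).
Hypotheses (tauK : involutive tau) (k_gt0 : 0 < k).
Implicit Types P Q : nanophrase alpha k.

(** Both nanophrases realise the phrase of [P], the standard one by renaming its two booleans to [A]
    and [B]. *)
Lemma isomorphic_nanoP P X ps (A B : P) :
  positionable X ps -> all (fun i => i < k) ps -> A != B ->
  occs 0 (phrase P) = [seq (e.1, if e.2 then A else B) | e <- pattern_occs X ps] ->
  exists Y : positions k X, isomorphic P (nanoP Y (lab A) (lab B)).
Proof.
move=> /andP[sz srt] ltk AB e.
pose Y0 : seq 'I_k := pmap insub ps.
have EY0 : map val Y0 = ps.
  rewrite pmap_filter; last exact: insubK.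
  by apply/all_filterP; apply: sub_all ltk => i ik; rewrite isSome_insub.
have szY : size Y0 == size (pattern X) by rewrite -(eqP sz) -EY0 size_map.
have srtY : sorted ltn [seq nat_of_ord i | i <- Y0] by rewrite EY0.
exists (Positions szY srtY); apply: (realizes_iso (realizes_phrase P)).
exists (fun c : bool => if c then A else B); split.
- by move=> [] [] // /eqP; rewrite ?(negPf AB) // eq_sym (negPf AB).
- by case.
apply: (@occs_inj _ 0); first by rewrite nbars_map !nbars_phrase.
by rewrite occs_map occs_nanoP /= EY0 e.
Qed.

Lemma four_letters P i1 i2 i3 i4 (x1 x2 x3 x4 : P) :
  occs 0 (phrase P) = [:: (i1, x1); (i2, x2); (i3, x3); (i4, x4)] ->
  [\/ [/\ x2 = x1, x4 = x3 & x1 != x3],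
      [/\ x3 = x1, x4 = x2 & x1 != x2] |
      [/\ x4 = x1, x3 = x2 & x1 != x2]].
Proof.
move=> e; have cnt A : count_mem A [:: x1; x2; x3; x4] = 2.
  by rewrite -(count_phrase A) -(count_occs 0) e.
have := cnt x1; have := cnt x2; have := cnt x3; rewrite /= !eqxx.
rewrite [x1 == x2]eq_sym [x1 == x3]eq_sym [x2 == x3]eq_sym.
case: (eqVneq x2 x1) => [->|n21].
  case: (eqVneq x3 x1) => [->|n31]; first by rewrite ?eqxx; lia.
  case: (eqVneq x4 x3) => [->|n43]; last by lia.
  by move=> _ _ _; constructor 1; split=> //; rewrite eq_sym.
case: (eqVneq x3 x1) => [->|n31].
  rewrite eq_sym (negPf n21); case: (eqVneq x4 x2) => [->|n42]; last by lia.
  by move=> _ _ _; constructor 2; split=> //; rewrite eq_sym.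
case: (eqVneq x4 x1) => [->|n41]; last by lia.
case: (eqVneq x3 x2) => [->|n32]; last by rewrite ![x1 == _]eq_sym (negPf n21); lia.
by move=> _ _ _; constructor 3; split=> //; rewrite eq_sym.
Qed.

Lemma four_letters_classification P : nletters P = 4 ->
  (exists Q, homotopic tau P Q /\ nletters Q <= 2)
  \/ (exists (X : ptype) (Y : positions k X) (a b : alpha),
        admissible tau X a b /\ isomorphic P (nanoP Y a b)).
Proof.
move=> nl4; have := nl4; rewrite nlettersE; have := occs_bounds 0 (phrase P).
rewrite add0n nbars_phrase.
case E: (occs 0 (phrase P)) => [|[i1 x1] [|[i2 x2] [|[i3 x3] [|[i4 x4] []]]]] //= bounds _.
have [i12 i23 i34 i4k] : [/\ i1 <= i2, i2 <= i3, i3 <= i4 & i4 < k] by split; lia.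
have std X ps (A B : P) : positionable X ps -> all (fun i => i < k) ps -> A != B ->
    admissible tau X (lab A) (lab B) ->
    occs 0 (phrase P) = [seq (e.1, if e.2 then A else B) | e <- pattern_occs X ps] ->
    exists X Y a b, admissible tau X a b /\ isomorphic P (@nanoP _ k X Y a b).
  move=> ok ltk AB adm e; have [Y iso] := isomorphic_nanoP ok ltk AB e.
  by exists X, Y, (lab A), (lab B).
have red1 X i A Y : occs 0 (phrase P) = X ++ (i, A) :: (i, A) :: Y ->
    exists Q, homotopic tau P Q /\ nletters Q <= 2.
  move=> h; have [x [y [e _]]] := occs_pair h; have [Q [hQ sz]] := reduce1 tau k_gt0 e.
  by exists Q; split=> //; lia.
have red2 i j A B : lab B = tau (lab A) ->
    occs 0 (phrase P) = [:: (i, A); (i, B); (j, B); (j, A)] ->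
    exists Q, homotopic tau P Q /\ nletters Q <= 2.
  move=> lAB h; have [x [y [e h']]] := occs_pair (X := [::]) h.
  have [z [t [e' _]]] := occs_pair (X := [::]) h'.
  rewrite e' in e; have [Q [hQ sz]] := reduce2 k_gt0 lAB e.
  by exists Q; split=> //; lia.
have red2' i j A B : lab B = tau (lab A) ->
    occs 0 (phrase P) = [:: (i, A); (i, B); (j, A); (j, B)] ->
    exists Q, homotopic tau P Q /\ nletters Q <= 2.
  move=> lAB h; have [x [y [e h']]] := occs_pair (X := [::]) h.
  have [z [t [e' _]]] := occs_pair (X := [::]) h'.
  rewrite e' in e; have [Q [hQ sz]] := reduce2' tauK k_gt0 lAB e.
  by exists Q; split=> //; lia.
have lt_or i j : i <= j -> i = j \/ i < j by rewrite leq_eqVlt => /orP[/eqP|]; [left|right].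
rewrite E in std red1 red2 red2'.
case: (four_letters E) => -[? ? x12]; subst.
(* AABB: without a cut inside AA and inside BB, the first move applies. *)
- case: (lt_or _ _ i12) => [?|l12]; first by subst; left; apply: (red1 [::]).
  case: (lt_or _ _ i34) => [?|l34]; first by subst; left; apply: (red1 [:: _; _]).
  case: (lt_or _ _ i23) => [?|l23]; subst; right.
    by apply: (@std T121I [:: i1; i3; i4] x1 x3); rewrite /positionable //=; lia.
  by apply: (@std T1111I [:: i1; i2; i3; i4] x1 x3); rewrite /positionable //=; lia.
(* ABAB: all eight cuts are listed; only the uncut word and AB|AB can be shortened, when |B| =
   tau(|A|). *)
- case: (lt_or _ _ i12) => [?|l12]; case: (lt_or _ _ i23) => [?|l23];
    case: (lt_or _ _ i34) => [?|l34]; subst.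
  + case: (eqVneq (lab x2) (tau (lab x1))) => [e|/eqP ne]; first by left; apply: red2' e _.
    right; apply: (@std T4 [:: i4] x1 x2); rewrite /positionable //=; first lia.
    by move=> e; case: ne; rewrite e tauK.
  + by right; apply: (@std T31 [:: i3; i4] x1 x2); rewrite /positionable //=; lia.
  + case: (eqVneq (lab x2) (tau (lab x1))) => [e|/eqP ne]; first by left; apply: red2' e _.
    right; apply: (@std T22I [:: i2; i4] x1 x2); rewrite /positionable //=; try lia.
    by move=> e; case: ne; rewrite e tauK.
  + by right; apply: (@std T211I [:: i2; i3; i4] x1 x2); rewrite /positionable //=; lia.
  + by right; apply: (@std T13 [:: i1; i4] x1 x2); rewrite /positionable //=; lia.
  + by right; apply: (@std T121II [:: i1; i3; i4] x1 x2); rewrite /positionable //=; lia.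
  + by right; apply: (@std T112I [:: i1; i2; i4] x1 x2); rewrite /positionable //=; lia.
  + by right; apply: (@std T1111II [:: i1; i2; i3; i4] x1 x2); rewrite /positionable //=; lia.
(* ABBA: the middle BB has to be cut, and AB|BA falls to the second move when |B| = tau(|A|). *)
- case: (lt_or _ _ i23) => [?|l23]; first by subst; left; apply: (red1 [:: _]).
  case: (lt_or _ _ i12) => [?|l12]; case: (lt_or _ _ i34) => [?|l34]; subst.
  + case: (eqVneq (lab x2) (tau (lab x1))) => [e|/eqP ne]; first by left; apply: red2 e _.
    right; apply: (@std T22II [:: i2; i4] x1 x2); rewrite /positionable //=; try lia.
    by move=> e; case: ne; rewrite e tauK.
  (* The phrase x1 x2|x2|x1 matches the pattern BA|A|B with [x2] as A, so the letters exchange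
     roles. *)
  + rewrite eq_sym in x12.
    by right; apply: (@std T211II [:: i2; i3; i4] x2 x1); rewrite /positionable //=; lia.
  + by right; apply: (@std T112II [:: i1; i2; i4] x1 x2); rewrite /positionable //=; lia.
  + by right; apply: (@std T1111III [:: i1; i2; i3; i4] x1 x2); rewrite /positionable //=; lia.
Qed.

End Classification.

Theorem theorem5p5 (alpha : finType) (tau : alpha -> alpha)
    (tauK : involutive tau) (k : nat) (k_gt0 : 0 < k) :
  (forall P : nanophrase alpha k, nletters P = 4 ->
     (exists Q : nanophrase alpha k, homotopic tau P Q /\ nletters Q <= 2)
     \/ (exists (X : ptype) (Y : positions k X) (a b : alpha),
           admissible tau X a b /\ isomorphic P (nanoP Y a b)))
  /\
  (forall (X X' : ptype) (Y : positions k X) (Y' : positions k X')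
          (a b a' b' : alpha),
     admissible tau X a b -> admissible tau X' a' b' ->
     homotopic tau (nanoP Y a b) (nanoP Y' a' b') <->
     [/\ X = X', pos Y = pos Y', a = a' & b = b']).
Proof.
split=> [P|X X' Y Y' a b a' b' adm adm']; first exact: four_letters_classification.
split; first exact: nanoP_homotopic_inj.
case=> EX EY -> ->; subst X'; case: Y Y' EY => ps sz srt [ps' sz' srt'] /= Eps.
(* The other fields of [positions] are proofs of boolean statements, so equal position lists give
   equal records. *)
subst ps'; rewrite (bool_irrelevance sz sz') (bool_irrelevance srt srt').
exact: rst_refl.
Qed.
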